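(* Let $T$ be a rooted, chain complete tree of height at most $\omega_1+1$, endowed with the coarse wedge topology. Then every closed subset of $T$ is a Valdivia compact space.
   Context: All topological spaces are assumed Hausdorff and completely regular. Trees. A tree is a partially ordered set $(T,\leq)$ such that for every $t\in T$ the set $\{s\in T: s<t\}$ is well-ordered by $<$. It is rooted if it has exactly one minimal element, and chain complete if every chain (totally ordered subset) has a supremum. For $t\in T$, $\mathrm{ht}(t,T)$ is the order type of $\{s\in T: s<t\}$; for an ordinal $\alpha$, $\mathrm{Lev}_\alpha(T)=\{t\in T:\mathrm{ht}(t,T)=\alpha\}$; the height of $T$ is the least $\alpha$ with $\mathrm{Lev}_\alpha(T)=\emptyset$. For $t\in T$, $\mathrm{cf}(t)$ is the cofinality of $\mathrm{ht}(t,T)$, with the convention $\mathrm{cf}(t)=0$ if $\mathrm{ht}(t,T)$ is $0$ or a successor ordinal. Put $I(T)=\{t\in T:\mathrm{cf}(t)<\omega\}$ and $V_t=\{s\in T: s\geq t\}$. The coarse wedge topology on $T$ is the topology whose subbase consists of the sets $V_t$ and $T\setminus V_t$ for $t\in I(T)$; it is compact Hausdorff when $T$ is rooted and chain complete. Valdivia compacta. For a set $\Gamma$, let $\Sigma(\Gamma)=\{x\in[0,1]^\Gamma: |\{\gamma\in\Gamma: x(\gamma)\neq0\}|\leq\omega\}$, where $[0,1]^\Gamma$ has the product topology. A compact space $K$ is Valdivia if there are a set $\Gamma$ and a homeomorphic embedding $h:K\to[0,1]^\Gamma$ such that $h^{-1}(\Sigma(\Gamma))$ is dense in $K$. *)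

(* Defs.v *)
From HB Require Import structures.
From mathcomp Require Import all_boot all_order all_algebra.
From mathcomp Require Import all_classical all_reals all_analysis.
From mathcomp Require Import wochoice.

Set Implicit Arguments.
Unset Strict Implicit.
Unset Printing Implicit Defensive.

Import Order.TTheory GRing.Theory Num.Theory.
Import numFieldNormedType.Exports.

Local Open Scope classical_set_scope.
Local Open Scope ring_scope.

(* An ordinal is represented by a well-ordered type; two representatives denote
   the same ordinal when they are order isomorphic ([oeq] below). The field [ole]
   is the reflexive order. *)
Record onum := Onum {
  onum_sort :> Type;
  ole : rel onum_sort;
  ole_wo : well_order ole
}.

Lemma wo_chain_sig (T : Type) (R : rel T) (C : {pred T}) :
  wo_chain R C -> well_order (fun x y : {x : T | x \in C} => R (sval x) (sval y)).
Proof.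
move=> RC A [a Aa].
pose B : {pred T} := [pred x | `[< exists2 y, y \in A & sval y = x >]].
have BC : sub_mem (mem B) (mem C).
  by move=> x /asboolP[[y Cy] _ <-].
have [z [[Bz zmin] zuniq]] : exists! z, minimum_of R B z.
  by apply: (RC B BC); exists (sval a); apply/asboolP; exists a.
have [y Ay yz] := asboolP _ Bz; subst z.
exists y; split.
  split=> // x Ax; apply: zmin.
  by apply/asboolP; exists x.
move=> x [Ax xmin]; apply: eq_sig_hprop => [?|]; first exact: bool_irrelevance.
apply: zuniq; split; first by apply/asboolP; exists x.
by move=> _ /asboolP[u Au <-]; exact: xmin.
Qed.

Definition onum_chain (T : Type) (R : rel T) (C : {pred T}) (wC : wo_chain R C) :
  onum := Onum (wo_chain_sig wC).

Definition onum_sub (a : onum) (C : {pred a}) : onum :=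
  onum_chain (withinW (ole_wo (o := a)) : wo_chain (@ole a) C).

Definition oeq (a b : onum) : Prop :=
  exists f : a -> b, bijective f /\ {mono f : x y / ole x y}.

Definition onum_seg (a : onum) (x : a) : onum :=
  onum_sub [pred y | ~~ ole x y].

Definition olt (a b : onum) : Prop := exists y : b, oeq a (onum_seg y).

Definition oleq (a b : onum) : Prop := olt a b \/ oeq a b.

Lemma void_wo : well_order (fun _ _ : void => true).
Proof. by move=> A [[]]. Qed.

Definition onum0 : onum := Onum void_wo.

Lemma nat_wo : well_order leq.
Proof.
apply: antisymmetric_well_order; first exact: anti_leq.
move=> A [n An]; have ex : exists m, m \in A by exists n.
by case: (ex_minnP ex) => m Am mmin; exists m; split.
Qed.

Definition onum_omega : onum := Onum nat_wo.

Definition option_ole (a : onum) : rel (option a) := fun x y =>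
  match x, y with
  | _, None => true
  | None, Some _ => false
  | Some x, Some y => ole x y
  end.

Lemma option_wo (a : onum) : well_order (@option_ole a).
Proof.
move=> A [x0 Ax0].
have [[x Ax]|nA] := pselect (exists x, Some x \in A).
  have : nonempty [pred x | Some x \in A] by exists x.
  move=> /(ole_wo (o := a))[z [[Az zmin] zuniq]].
  exists (Some z); split.
    by split=> // -[y|] // Ay; apply: (zmin y).
  move=> [y|] [Ay ymin]; last by have := ymin _ Az.
  congr Some; apply: zuniq; split => // u Au; exact: (ymin (Some u)).
have AN y : y \in A -> y = None.
  by case: y => // y Ay; exfalso; apply: nA; exists y.
exists None; split; first by split=> [|y /AN ->//]; rewrite -(AN _ Ax0).
by move=> y [/AN].
Qed.

Definition onumS (a : onum) : onum := Onum (@option_wo a).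

(* The points of a well-ordering of the uncountable set [set nat] that have only
   countably many predecessors form an uncountable initial segment all of whose
   proper initial segments are countable. *)
Definition set_nat_wo : onum :=
  Onum (proj2_sig (well_ordering_principle (set nat))).

Definition onum_omega1 : onum :=
  onum_sub [pred x : set_nat_wo | `[< countable [set y | ~~ ole x y] >]].

Lemma uncountable_set_nat : ~ countable [set: set nat].
Proof.
move=> /countable_injP[f finj].
pose D := [set n | exists2 S : set nat, f S = n & ~ S n].
have [DfD|nDfD] := pselect (D (f D)).
  case: (DfD) => S fSD; apply; suff -> : S = D by [].
  by apply: finj; rewrite ?in_setT.
by apply: (nDfD); exists D.
Qed.

Lemma onum_omega1_uncountable : ~ countable [set: onum_omega1].
Proof.
set C : {pred set_nat_wo} := [pred x | `[< countable [set y | ~~ ole x y] >]].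
move=> c1.
have cC : countable [set x : set_nat_wo | x \in C].
  have := sub_countable (card_image_le (sval : onum_omega1 -> set_nat_wo) setT) c1.
  apply: sub_countable.
  by apply: subset_card_le => x Cx; exists (exist _ x Cx).
have [CT|] := pselect (forall x, x \in C).
  apply: uncountable_set_nat; apply: sub_countable cC.
  by apply: subset_card_le => x _; exact: CT.
move=> /existsNP[x0 /negP Cx0].
have : nonempty [predC C] by exists x0.
move=> /(ole_wo (o := set_nat_wo))[m [[mC mmin] _]].
move/negP: mC; apply; apply/asboolP; apply: sub_countable cC.
apply: subset_card_le => y /= my; apply/negPn/negP => yC.
by move/negP: my; apply; exact: mmin.
Qed.

Lemma onum_omega1_seg_countable (x : onum_omega1) :
  countable [set y | ~~ ole x y].
Proof.
case: x => x Cx; have /asboolP/countable_injP[f finj] := Cx.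
apply/countable_injP; exists (f \o sval) => -[y Cy] [z Cz].
rewrite !inE => /= xy xz fyz; apply: eq_sig_hprop => [?|/=].
  exact: bool_irrelevance.
by apply: finj; rewrite ?inE.
Qed.
(* A successor has a cofinal singleton, but by convention its cofinality is 0. *)
Definition olimit (a : onum) : Prop :=
  ~ oeq a onum0 /\ ~ exists b, oeq a (onumS b).

Definition cofinal (a : onum) (A : {pred a}) : Prop :=
  forall x, exists2 y, y \in A & ole x y.

Definition is_cofinality (a k : onum) : Prop :=
  (~ olimit a -> oeq k onum0) /\
  (olimit a ->
     (exists2 A : {pred a}, cofinal A & oeq k (onum_sub A)) /\
     (forall A : {pred a}, cofinal A -> oleq k (onum_sub A))).

HB.mixin Record POrder_isTree d T & Order.POrder d T := {
  tree_wo : forall t : T, wo_chain <=%O [pred s : T | (s < t)%O]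
}.

#[short(type="treeType")]
HB.structure Definition Tree d := {T of POrder_isTree d T & Order.POrder d T}.

Section Tree.
Context {d : Order.disp_t} (T : treeType d).

Definition rooted : Prop := exists! r : T, minimal <=%O r.

Definition chain_complete : Prop :=
  forall C : set T, total_on C <=%O -> supremums C !=set0.

Definition ht (t : T) : onum := onum_chain (tree_wo t).

Definition Lev (a : onum) : set T := [set t | oeq (ht t) a].

Definition is_height (a : onum) : Prop :=
  Lev a = set0 /\ forall b, Lev b = set0 -> oleq a b.

Definition cf_finite : set T :=
  [set t | exists2 k, is_cofinality (ht t) k & olt k onum_omega].

Definition wedge (t : T) : set T := [set s | (t <= s)%O].

Definition wedge_subbase : set (set T) :=
  [set U | exists2 t, cf_finite t & U = wedge t \/ U = ~` wedge t].

Definition coarse_wedge : Type := T.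

HB.instance Definition _ := Tree.copy coarse_wedge T.

HB.instance Definition _ :=
  isSubBaseTopological.Build coarse_wedge wedge_subbase id.

End Tree.

Definition embedding {X Y : topologicalType} (h : X -> Y) : Prop :=
  [/\ injective h, continuous h &
      forall U : set X, open U ->
        exists2 V : set Y, open V & h @` U = V `&` range h].

Definition cube (R : realType) (Gamma : Type) : topologicalType :=
  prod_topology (fun _ : Gamma => set_type `[0%R : R, 1%R]%classic).

Definition Sigma (R : realType) (Gamma : Type) : set (cube R Gamma) :=
  [set x | countable [set gamma | set_val (x gamma) <> 0]].

(* Spaces are assumed Hausdorff and completely regular; for a compact space
   complete regularity follows from the Hausdorff property. *)
Definition valdivia (R : realType) (X : topologicalType) : Prop :=
  [/\ hausdorff_space X, compact [set: X] &
      exists (Gamma : Type) (h : X -> cube R Gamma),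
        embedding h /\ dense (h @^-1` @Sigma R Gamma)].

(* Main.v *)
Require Import Defs.
From mathcomp Require Import all_boot all_order all_algebra.
From mathcomp Require Import all_classical all_reals all_analysis.
From mathcomp Require Import wochoice.

(** Write V_s for the wedge of s, and call a node a limit node when it is not
    minimal and its strict predecessors have no maximum; the nodes s whose
    wedges V_s generate the topology, as clopen sets, are exactly the nodes
    that are not limits ([cf_finiteP]). Since the tree is chain complete, a
    limit node is the supremum of its predecessors, so these wedges separate
    points, and an ultrafilter F converges to the supremum of the chain of all
    s with V_s in F: the tree is compact and totally disconnected, and so is
    every closed subset K.

    The embedding of K sends x to the family of its traces, that is, of the
    sets K `&` V_s with s <= x and s not a limit ([traces],
    [trace_map]). The cube is indexed by sets of nodes and not by the nodes
    themselves: two nodes with the same trace on K share one coordinate. This is essential. A point x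
    with uncountably many predecessors may well be isolated in K; then
    uncountably many nodes lie below x, whereas their traces are eventually
    constant and hence only countably many.

    It remains to approximate a point x of K with uncountably many traces by
    points of K with countably many traces ([dense_countable_traces]). By
    the bound on the height, every s < x has only countably many predecessors.
    Hence x is a limit node, and above every s < x the trace still shrinks:
    there are s' between s and x and a point of K in V_s that is not in V_s'
    ([traces_drop]). Iterating from any s 0 < x yields an increasing
    sequence s n and points z n of K in V_(s n) minus V_(s n.+1). The branching
    forces z n to converge to y, the supremum of the s n ([drops_cvg]), so y
    lies in K because K is closed. Finally y < x, because x has uncountable
    cofinality, so y has countably many predecessors and thus countably many
    traces; and y is as close to x as desired since s 0 <= y < x.

    The bound on the height is used through ranks ([tree_below_countable]):
    nodes of the tree are matched with elements of the ordinal h by the largest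
    bisimulation between the two strict orders. *)

Set Implicit Arguments.
Unset Strict Implicit.
Unset Printing Implicit Defensive.

Import Order.TTheory GRing.Theory Num.Theory.
Import numFieldNormedType.Exports.

Local Open Scope classical_set_scope.

(** * Well-orders and the order of a tree *)

Lemma well_order_min (T : Type) (R : rel T) (A : set T) :
  well_order R -> A !=set0 -> exists2 m, A m & forall x, A x -> R m x.
Proof.
move=> wR [a Aa].
have [|m [[/asboolP Am mmin] _]] := wR [pred x | `[< A x >]].
  by exists a; apply/asboolP.
by exists m => // x Ax; apply: mmin; apply/asboolP.
Qed.

Lemma well_order_total (T : Type) (R : rel T) : well_order R -> total R.
Proof.
move=> wR x y.
have [|_ [] -> mmin] := well_order_min wR (A := [set z | z = x \/ z = y]).
- by exists x; left.
- by rewrite mmin //; right.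
- by rewrite (mmin x) ?orbT //; left.
Qed.

Lemma well_order_refl (T : Type) (R : rel T) : well_order R -> reflexive R.
Proof. by move=> wR x; have := well_order_total wR x x; rewrite orbb. Qed.

Lemma well_order_anti (T : Type) (R : rel T) : well_order R -> antisymmetric R.
Proof.
move=> wR x y /andP[xy yx].
have [|m [_ muniq]] := wR [pred z | `[< z = x \/ z = y >]].
  by exists x; apply/asboolP; left.
have mE u : u = x \/ u = y -> m = u.
  move=> uE; apply: muniq; split; first exact/asboolP.
  by case: uE => -> z /asboolP[] ->; rewrite ?(well_order_refl wR).
by rewrite -[LHS](mE x) ?(mE y); [|right|left].
Qed.

Section TreeOrder.
Context {d : Order.disp_t} (T : treeType d).
Implicit Types (r s t x y : T).
Local Open Scope order_scope.
Local Open Scope classical_set_scope.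

Lemma tree_min (A : set T) t :
  A !=set0 -> A `<=` [set s | s <= t] ->
  exists2 m, A m & forall s, A s -> m <= s.
Proof.
move=> A0 At.
have [[s [As st]]|nlt] := pselect (exists s, A s /\ s < t).
  have sub : {subset [pred r | `[< A r /\ r < t >]] <= [pred r | r < t]}.
    by move=> r /asboolP[].
  have [|m [[/asboolP[Am mt] mmin] _]] := tree_wo t _ sub.
    by exists s; apply/asboolP.
  exists m => // r Ar; have := At _ Ar; rewrite /= le_eqVlt => /predU1P[->|rt].
    exact: ltW.
  by apply: mmin; apply/asboolP.
have At1 s : A s -> s = t.
  move=> As; have := At _ As; rewrite /= le_eqVlt => /predU1P[//|st].
  by exfalso; apply: nlt; exists s.
by case: A0 => a Aa; exists a => // s /At1 ->; rewrite (At1 a).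
Qed.

Lemma tree_below_total r s t : r <= t -> s <= t -> (r <= s) || (s <= r).
Proof.
move=> rt st; have [||m []] := @tree_min [set r; s] t.
- by exists r; left.
- by move=> _ [] ->.
  by move=> -> mmin; rewrite mmin //; right.
by move=> -> mmin; rewrite (mmin r) ?orbT //; left.
Qed.

(** In a tree, strict order is not the negation of the reverse order in
    general; below a common node it is. *)
Lemma tree_below_ltNge r s t : r <= t -> s <= t -> (r < s) = ~~ (s <= r).
Proof.
move=> rt st; have [|sr] := boolP (s <= r); first by move=> /le_gtF.
have := tree_below_total rt st; rewrite (negPf sr) orbF => rs.
by rewrite lt_neqAle rs andbT; apply: contraNN sr => /eqP ->.
Qed.

Lemma tree_ind (P : T -> Prop) :
  (forall t, (forall s, s < t -> P s) -> P t) -> forall t, P t.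
Proof.
move=> IH t; apply: contrapT => nPt.
have [||m [nPm mt] mmin] := @tree_min [set s | ~ P s /\ s <= t] t.
- by exists t.
- by move=> s [].
apply/nPm/IH => s sm; apply: contrapT => nPs.
have /le_gtF := mmin s (conj nPs (le_trans (ltW sm) mt)).
by rewrite sm.
Qed.

(** * Wedges of finite cofinality *)

Definition limit_node t :=
  (exists s, s < t) /\ forall s, s < t -> exists2 r, s < r & r < t.

(** If t has a greatest strict predecessor s, then its height is the successor
    of the height of s: s itself plays the role of the added top element. *)
Lemma olimit_limit_node t : olimit (ht t) -> limit_node t.
Proof.
move=> [nz nS]; split.
  apply: contrapT => nlt; apply: nz.
  have F : ht t -> False by case=> s st; apply: nlt; exists s.
  exists (fun u => False_rect void (F u)); split.
    by exists (fun v : void => match v with end); [move=> u|case]; case: (F u).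
  by move=> u; case: (F u).
move=> s st; apply: contrapT => nr; apply: nS; exists (ht s).
have notlt (r : T) : r < t -> ~~ (r < s) -> r = s.
  move=> rt; rewrite (tree_below_ltNge (ltW rt) (ltW st)) negbK le_eqVlt.
  by case/predU1P => // sr; exfalso; apply: nr; exists r.
pose f (u : ht t) : onumS (ht s) :=
  if boolP (sval u < s) is AltTrue h then Some (exist _ (sval u) h) else None.
pose g (v : onumS (ht s)) : ht t :=
  if v is Some w then exist _ (sval w) (lt_trans (svalP w) st)
  else exist _ s st.
exists f; split.
  exists g.
    move=> [r rt]; rewrite /f /=; case: {-}_ / boolP => [rs|rs] /=;
    by apply: eq_exist => //=; rewrite (notlt r).
  case=> [[r rs]|]; rewrite /f /=; case: {-}_ / boolP => //=.
  - by move=> h; congr Some; apply: eq_exist.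
  - by rewrite (rs : r < s).
  - by move=> ss; exfalso; rewrite ltxx in ss.
move=> [r rt] [r' r't]; rewrite /f /=.
case: {-}_ / boolP => rs; case: {-}_ / boolP => r's //=.
- by rewrite (notlt r') // (ltW rs).
- by rewrite (notlt r) // (lt_geF r's).
- by rewrite (notlt r) // (notlt r') // lexx.
Qed.

Lemma no_olimit_cf_finite t : ~ olimit (ht t) -> cf_finite t.
Proof.
move=> nl; exists onum0.
  split=> [_|//]; exists id; split=> //.
  exact: (inv_bij (fun v : void => erefl)).
exists 0%N; have F : onum_seg (0%N : onum_omega) -> False by case.
exists (fun v : onum0 => match v with end); split; last by case.
by exists (fun u => False_rect void (F u)); [case|move=> u; case: (F u)].
Qed.

(** A cofinal subset of the predecessors of a limit node is infinite: a finite
    one would be bounded by a single predecessor. *)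
Lemma cf_finite_no_limit t : cf_finite t -> ~ limit_node t.
Proof.
move=> [k [_ kl] [n [g [[g' gK _] _]]]] [[s0 s0t] dense_t].
have [|[A cA [f [[f' _ f'K] _]]] _] := kl.
  split.
    by case=> f [_ _]; case: (f (exist _ s0 s0t)).
  case=> b [f [[f' fK f'K] fm]].
  have [r sr rt] := dense_t _ (svalP (f' None)).
  have := fm (exist _ r rt) (f' None); rewrite f'K.
  by case: (f _) => [?|] /= E; have := lt_geF sr; rewrite -E.
(* f enumerates a cofinal set A along k, and g numbers the elements of k
   below n; the images of the elements numbered below m have an upper bound that
   is strictly below t. *)
have bounded (m : nat) : exists2 s, s < t &
    forall u : k, (sval (g u) < m)%N -> sval (sval (f u)) <= s.
  elim: m => [|m [s st sP]]; first by exists s0.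
  have [[u um]|nu] := pselect (exists u : k, sval (g u) = m); last first.
    exists s => // u; rewrite ltnS leq_eqVlt => /predU1P[um|]; last exact: sP.
    by exfalso; apply: nu; exists u.
  pose r := sval (sval (f u)).
  have rt : r < t := svalP (sval (f u)).
  have uE v : sval (g v) = m -> v = u.
    move=> vm; apply: (can_inj gK); apply: eq_sig_hprop => [?|].
      exact: bool_irrelevance.
    by rewrite vm um.
  have [rs|sr] := orP (tree_below_total (ltW rt) (ltW st)).
    exists s => // v; rewrite ltnS leq_eqVlt => /predU1P[/uE ->//|]; exact: sP.
  exists r => // v; rewrite ltnS leq_eqVlt => /predU1P[/uE ->//|].
  by move=> /sP /le_trans; apply.
have [s st sP] := bounded n.
have [r sr rt] := dense_t _ st.
have [a Aa ra] := cA (exist _ r rt).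
have := sP (f' (exist _ a Aa)); rewrite f'K /=.
case: (g _) => /= m; rewrite inE /= -ltnNge => mn /(_ mn) as_.
by have := lt_le_trans sr (le_trans ra as_); rewrite ltxx.
Qed.

(** This replaces the cofinality, defined through ordinals, by a condition on
    the order of the tree alone. *)
Lemma cf_finiteP t : cf_finite t <-> ~ limit_node t.
Proof.
split; first exact: cf_finite_no_limit.
by move=> nl; apply: no_olimit_cf_finite => /olimit_limit_node.
Qed.

Lemma not_limit_node t : ~ limit_node t ->
  (forall s, ~ s < t) \/
  exists2 s, s < t & forall r, r < t -> r <= s.
Proof.
move=> nl; have [[s0 s0t]|ns] := pselect (exists s, s < t); last first.
  by left=> s st; apply: ns; exists s.
right; apply: contrapT => nmax; apply: nl; split; first by exists s0.
move=> s st; apply: contrapT => nr; apply: nmax; exists s => // r rt.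
have [//|sr] := boolP (r <= s); exfalso; apply: nr; exists r => //.
by rewrite (tree_below_ltNge (ltW st) (ltW rt)).
Qed.

End TreeOrder.

(** * Ranks of nodes in an ordinal *)

Lemma countable_inj (S U : Type) (A : set S) (B : set U) (f : S -> U) :
  {homo f : x / A x >-> B x} -> {in A &, injective f} -> countable B ->
  countable A.
Proof.
move=> AB finj /countable_injP[g ginj]; apply/countable_injP.
exists (g \o f) => x y xA yA /= E; apply: finj => //.
by apply: ginj; rewrite ?inE //; apply: AB; apply/set_mem.
Qed.

(** The bound a above b excludes the only case with uncountably many elements
    below b, namely b being the point at position omega_1. *)
Lemma onumS_omega1_seg_countable (h : onum) (a b : h) :
  oleq h (onumS onum_omega1) -> ~~ ole a b -> countable [set c | ~~ ole b c].
Proof.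
move=> h_le ab.
have [G Ginj Gmono] : exists2 G : h -> option onum_omega1,
    injective G & {mono G : x y / ole x y >-> option_ole x y}.
  case: h_le => [[y]|] [f [[f' fK _] fm]]; last first.
    by exists f => //; exact: can_inj fK.
  exists (sval \o f) => [u v /= uv|u v]; last exact: fm.
  apply: (can_inj fK); apply: eq_sig_hprop => [?|//]; exact: bool_irrelevance.
move: ab; rewrite -Gmono; case Gb : (G b) => [w|]; last by case: (G a).
move=> _; have lt_some c : ~~ ole b c -> exists2 v, G c = Some v & ~~ ole w v.
  by rewrite -Gmono Gb; case: (G c) => [v|//]; exists v.
apply: countable_inj (onum_omega1_seg_countable w) => [c|].
  by move=> /lt_some[v Gc wv]; instantiate (1 := odflt w \o G); rewrite /= Gc.
move=> c c' /set_mem/lt_some[v Gc _] /set_mem/lt_some[v' Gc' _] /=.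
by rewrite Gc Gc' /= => vv'; apply: Ginj; rewrite Gc Gc' vv'.
Qed.

Section Rank.
Context {d : Order.disp_t} (T : treeType d) (h : onum).
Implicit Types (r s t : T) (a b c : h).
Local Open Scope order_scope.
Local Open Scope classical_set_scope.

Definition bisimulation (R : T -> h -> Prop) : Prop := forall t a, R t a ->
  (forall s, s < t -> exists2 b, ~~ ole a b & R s b) /\
  (forall b, ~~ ole a b -> exists2 s, s < t & R s b).

(** The largest bisimulation. It relates t to a exactly when the predecessors of
    t and of a are isomorphic, but unlike an isomorphism of initial segments it
    can be handled by plain induction. *)
Definition has_rank t a : Prop := exists2 R, bisimulation R & R t a.

Lemma has_rank_bisimulation : bisimulation has_rank.
Proof.
move=> t a [R Rb Rta]; have [fwd bwd] := Rb _ _ Rta; split.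
  by move=> s /fwd[b ab Rsb]; exists b => //; exists R.
by move=> b /bwd[s st Rsb]; exists s => //; exists R.
Qed.

Lemma has_rank_uniq t a b : has_rank t a -> has_rank t b -> a = b.
Proof.
move: t a b; apply: tree_ind => t IH a b.
have half a' b' : has_rank t a' -> has_rank t b' -> ole a' b'.
  move=> /has_rank_bisimulation[_ bwd] /has_rank_bisimulation[fwd _].
  apply: contrapT => /negP /bwd[s st sb'].
  have [c b'c sc] := fwd _ st.
  by rewrite (IH s st b' c sb' sc) (well_order_refl (ole_wo (o := h))) in b'c.
move=> ta tb; apply: (well_order_anti (ole_wo (o := h))).
by rewrite !half.
Qed.

Lemma has_rank_lt s t a b : has_rank s a -> has_rank t b -> s < t -> ~~ ole b a.
Proof.
move=> sa /has_rank_bisimulation[fwd _] /fwd[c bc sc].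
by rewrite (has_rank_uniq sa sc).
Qed.

Lemma has_rank_mono s t r a b : s <= r -> t <= r ->
  has_rank s a -> has_rank t b -> ole a b = (s <= t).
Proof.
move=> sr tr sa tb; have [st|] := boolP (s <= t).
  move: st; rewrite le_eqVlt => /predU1P[st|st].
    subst t; rewrite (has_rank_uniq sa tb).
    exact: well_order_refl (ole_wo (o := h)) _.
  have := well_order_total (ole_wo (o := h)) a b.
  by rewrite (negPf (has_rank_lt sa tb st)) orbF.
by rewrite -(tree_below_ltNge tr sr) => /(has_rank_lt tb sa)/negbTE.
Qed.

Lemma has_rank_ht t :
  (forall s, s < t -> exists a, has_rank s a) ->
  (forall a, exists2 s, s < t & has_rank s a) -> Lev (T := T) h t.
Proof.
move=> rk /(_ _)/cid2 hit.
have /choice[f fP] (u : ht t) : exists a, has_rank (sval u) a := rk _ (svalP u).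
pose g a : ht t := exist _ (s2val (hit a)) (s2valP (hit a)).
have gP a : has_rank (sval (g a)) a := s2valP' (hit a).
have fm : {mono f : x y / ole x y}.
  case=> [r rt] [r' r't].
  have := has_rank_mono (ltW rt) (ltW r't)
    (fP (exist _ r rt)) (fP (exist _ r' r't)).
  exact.
exists f; split=> //; exists g => [u|a].
  2: exact: has_rank_uniq (fP _) (gP a).
apply: (well_order_anti (ole_wo (o := ht t))).
have fgf : f (g (f u)) = f u by exact: has_rank_uniq (fP _) (gP (f u)).
by rewrite -!fm fgf (well_order_refl (ole_wo (o := h))).
Qed.

(** If every node below t has a rank, then t gets the least element of h that is
    not one of these ranks; it exists, because otherwise t would have height
    exactly h. *)
Lemma has_rank_total t : Lev (T := T) h = set0 -> exists a, has_rank t a.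
Proof.
move=> Lh0; move: t; apply: tree_ind => t IH.
have [hit|] := pselect (forall a, exists2 s, s < t & has_rank s a).
  by have := has_rank_ht IH hit; rewrite Lh0.
move=> /existsNP[a0 na0].
have [|a na amin] := well_order_min (ole_wo (o := h))
    (A := [set a | ~ exists2 s, s < t & has_rank s a]); first by exists a0.
exists a, (fun s b => has_rank s b \/ (s = t /\ b = a)); last by right.
move=> s b [sb|[-> ->]].
  have [fwd bwd] := has_rank_bisimulation sb; split.
    by move=> s' /fwd[b' ? ?]; exists b' => //; left.
  by move=> b' /bwd[s' ? ?]; exists s' => //; left.
split=> [s' s't|b' ab'].
  have [b' s'b'] := IH _ s't; exists b'; last by left.
  apply/negP => ab'; apply: na.
  have [b'a|/(has_rank_bisimulation s'b').2[r rs' ra]] := boolP (ole b' a).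
    exists s' => //; suff -> : a = b' by [].
    by apply: (well_order_anti (ole_wo (o := h))); rewrite ab'.
  by exists r => //; exact: lt_trans s't.
have [s' s't s'b'] : exists2 s', s' < t & has_rank s' b'.
  by apply: contrapT => nb'; move/negP: ab'; apply; exact: amin.
by exists s' => //; left.
Qed.

Lemma tree_below_countable s t : is_height T h -> oleq h (onumS onum_omega1) ->
  s < t -> countable [set r | r < s].
Proof.
move=> [Lh0 _] h_le st.
have /choice[f fP] r := has_rank_total r Lh0.
have := onumS_omega1_seg_countable h_le (has_rank_lt (fP s) (fP t) st).
apply: (countable_inj (f := f)) => [r|r r'].
  exact: has_rank_lt (fP r) (fP s).
move=> /set_mem/ltW rs /set_mem/ltW r's ff.
apply: le_anti; rewrite -(has_rank_mono rs r's (fP r) (fP r')).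
rewrite -(has_rank_mono r's rs (fP r') (fP r)) -ff.
by rewrite (well_order_refl (ole_wo (o := h))).
Qed.

End Rank.

(** * The coarse wedge topology *)

Section Wedge.
Context {d : Order.disp_t} (T : treeType d).
Implicit Types (a r s t x y : T) (F : set_system (coarse_wedge T)).
Local Open Scope order_scope.
Local Open Scope classical_set_scope.

Lemma cvg_wedge F (x : coarse_wedge T) : Filter F ->
  (forall a, cf_finite a -> a <= x -> F (wedge a)) ->
  (forall a, cf_finite a -> ~ a <= x -> F (~` wedge a)) -> F --> x.
Proof.
move=> FF Fle Fnle A; rewrite /= nbhsE => -[B [[D DfinI <-] [C DC Cx]] BA].
apply: (@filterS _ F _ C) => [z Cz|]; first by apply: BA; exists C.
have [E Esub CE] := DfinI _ DC.
move: Cx; rewrite -CE => Cx; apply: filter_bigI => U UE.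
have := Cx _ UE; have := Esub _ UE; rewrite inE => -[a acf [->|->]].
  exact: Fle.
exact: Fnle.
Qed.

Lemma open_wedge_subbase (U : set (coarse_wedge T)) : wedge_subbase U -> open U.
Proof.
move=> sU; exists [set U]; last by rewrite bigcup_set1.
by move=> _ ->; exact: (finI_from1 (@id (set T))).
Qed.

Lemma open_wedge a : cf_finite a -> open (wedge a : set (coarse_wedge T)).
Proof. by move=> acf; apply: open_wedge_subbase; exists a => //; left. Qed.

Lemma open_wedgeC a : cf_finite a -> open (~` wedge a : set (coarse_wedge T)).
Proof. by move=> acf; apply: open_wedge_subbase; exists a => //; right. Qed.

Hypothesis Tcc : chain_complete T.

(** For an ultrafilter F, the nodes s with V_s in F form a chain, because two
    meeting wedges have comparable roots. Its supremum t is the limit of F: a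
    subbasic wedge V_a around t contains V_c for some member c of the chain,
    unless all members are strictly below a. Then a is equal to t, the supremum
    of members strictly below it, without being a limit; this leaves only the
    case where a is the root and V_a the whole tree. *)
Lemma compact_coarse_wedge : compact [set: coarse_wedge T].
Proof.
rewrite compact_ultra => F UF _.
have PF : ProperFilter F by exact: ultra_proper.
pose C : set T := [set s | F (wedge s)].
have [|t [ubt lubt]] := @Tcc C.
  move=> r s Fr Fs; have [z [rz sz]] := filter_ex (filterI Fr Fs).
  exact/orP/(tree_below_total rz sz).
exists (t : coarse_wedge T); split=> //; apply: cvg_wedge.
  move=> a /cf_finiteP acf ta.
  have [[c Cc ac]|nC] := pselect (exists2 c, C c & a <= c).
    by apply: filterS Cc => z; exact: le_trans.
  have Clt c : C c -> c < a.
    move=> Cc; rewrite (tree_below_ltNge (ubt _ Cc) ta).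
    by apply/negP => ac; apply: nC; exists c.
  have {ta} ta : t = a.
    by apply: le_anti; rewrite ta andbT; apply: lubt => c /Clt/ltW.
  have [nlt|[s sa smax]] := not_limit_node acf.
    have [|o [_ olub]] := @Tcc set0; first by [].
    have oz z : o <= z by apply: olub.
    have := oz a; rewrite le_eqVlt => /predU1P[<-|/nlt//].
    by apply: filterS filterT => z _; exact: oz.
  suff : t <= s by rewrite ta (lt_geF sa).
  by apply: lubt => c /Clt/smax.
move=> a acf ta; have [Fa|//] := in_ultra_setVsetC (wedge a) UF.
by exfalso; exact/ta/ubt.
Qed.

(** The intervals [s, x] with s < x generate a filter that converges to x, since
    a subbasic neighbourhood of x that is a wedge has its root strictly below
    x. *)
Lemma limit_node_nbhs (x : coarse_wedge T) (U : set (coarse_wedge T)) :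
  limit_node (x : T) -> open U -> U x ->
  exists2 s : T, s < x & forall y : T, s <= y -> y <= x -> U y.
Proof.
move=> limx oU Ux; have [[s0 s0x] _] := limx.
pose tails := filter_from [set s : T | s < x]
  (fun s => [set y : coarse_wedge T | s <= y /\ y <= x]).
have Ft : Filter tails.
  apply: filter_from_filter => [|r s /= rx sx]; first by exists s0.
  have [rs|sr] := orP (tree_below_total (ltW rx) (ltW sx));
    [exists s|exists r] => //.
    by move=> y /= [sy yx]; split=> //; split=> //; exact: le_trans sy.
  by move=> y /= [ry yx]; split=> //; split=> //; exact: le_trans ry.
have [] : tails U; last by move=> s /= sx sU; exists s => // y sy yx; apply: sU.
have /(_ U) : tails --> x; last by apply; exact: open_nbhs_nbhs.
apply: cvg_wedge => a.
  move=> /cf_finiteP acf; rewrite le_eqVlt => /predU1P[ax|ax].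
    by rewrite ax in acf.
  by exists a => // y [].
move=> acf ax; by exists s0 => // y [_ yx] ay; apply: ax; exact: le_trans yx.
Qed.

(** * Points with countably many traces *)

Definition traces (K : set (coarse_wedge T)) (x : T) : set (set T) :=
  [set A | exists2 s, cf_finite s /\ s <= x & A = K `&` wedge s].

Lemma countable_below_le x :
  countable [set r | r < x] -> countable [set r | r <= x].
Proof.
move=> cx; have -> : [set r | r <= x] = [set x] `|` [set r | r < x].
  rewrite eqEsubset; split=> r /=; last by case=> [->|/ltW].
  by rewrite le_eqVlt => /predU1P[->|]; [left|right].
rewrite -bigcup2E; apply: bigcup_countable => // -[_|[_|n _]] //.
exact: countable1.
Qed.

Lemma countable_traces K x :
  countable [set r | r < x] -> countable (traces K x).
Proof.
move=> cx; have : countable ((fun s => K `&` wedge s) @` [set r | r <= x]).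
  exact/(sub_countable (card_image_le _ _))/countable_below_le.
apply: sub_countable; apply: subset_card_le => _ [s [_ sx] ->]; by exists s.
Qed.

Lemma uncountable_limit_node x :
  (forall s, s < x -> countable [set r | r < s]) ->
  ~ countable [set r | r < x] -> limit_node x.
Proof.
move=> cx ncx; apply: contrapT => /not_limit_node[nlt|[s sx smax]]; apply: ncx.
  by apply: sub_countable (countable0 T); apply: subset_card_le => r /nlt.
have : countable [set r | r <= s] by exact/countable_below_le/cx.
by apply: sub_countable; apply: subset_card_le => r /smax.
Qed.

(** If there were no such s', every trace taken between s and x would equal the
    trace of s, and all traces at x would come from the countably many nodes
    up to s. *)
Lemma traces_drop K x s : limit_node x -> ~ countable (traces K x) ->
  countable [set r | r < s] -> s < x ->
  exists s' z, [/\ s < s' , s' < x, K z, s <= z & ~ s' <= z].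
Proof.
move=> limx ncx cs sx; apply: contrapT => nex; apply: ncx.
have : countable ((fun s => K `&` wedge s) @` [set r | r <= s]).
  exact/(sub_countable (card_image_le _ _))/countable_below_le.
apply: sub_countable; apply: subset_card_le => _ [r [/cf_finiteP rcf rx] ->].
have {rx} rx : r < x.
  by move: rx; rewrite le_eqVlt => /predU1P[rx|//]; rewrite rx in rcf.
have [rs|sr] := boolP (r <= s).
  by exists r.
rewrite -(tree_below_ltNge (ltW sx) (ltW rx)) in sr.
exists s => //=.
rewrite eqEsubset; split=> z [Kz]; rewrite /wedge /= => sz; split=> //.
  by apply: contrapT => nrz; apply: nex; exists r, z.
exact: le_trans (ltW sr) sz.
Qed.

(** A node a that is not below y lies under at most one z n. Indeed, if a is
    below z m then a is comparable with s m, and s m <= a since a is not below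
    y; so a <= z n with n < m would put s n.+1 below z n. *)
Lemma drops_cvg (s z : nat -> T) (y : T) :
  (forall n, s n < s n.+1) -> supremums (range s) y ->
  (forall n, s n <= z n) -> (forall n, ~ s n.+1 <= z n) ->
  (z : nat -> coarse_wedge T) @ \oo --> (y : coarse_wedge T).
Proof.
move=> sS [uby luby] sz nsz.
have sm : {homo s : m n / (m <= n)%N >-> m <= n}.
  by apply: homo_leq => [//|? ? ?|n]; [exact: le_trans|exact/ltW].
have sy n : s n <= y by apply: uby; exists n.
have below a : a < y -> exists n, a < s n.
  move=> ay; apply: contrapT => na.
  suff : y <= a by rewrite (lt_geF ay).
  apply: luby => _ [n _ <-]; have [//|sa] := boolP (s n <= a).
  exfalso; apply: na.
  by exists n; rewrite (tree_below_ltNge (ltW ay) (sy n)).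
have limy : limit_node y.
  split; first by exists (s 0%N); exact: lt_le_trans (sS _) (sy 1%N).
  move=> a /below[n an]; exists (s n) => //; exact: lt_le_trans (sS _) (sy _).
apply: cvg_wedge => a.
  move=> /cf_finiteP acf; rewrite le_eqVlt => /predU1P[ay|].
    by rewrite ay in acf.
  move=> /below[n an]; exists n => // m /= nm.
  exact: le_trans (ltW an) (le_trans (sm _ _ nm) (sz m)).
move=> acf ay; have [[n azn]|naz] := pselect (exists n, a <= z n); last first.
  by exists 0%N => // n _ azn; apply: naz; exists n.
exists n.+1 => // m /= nm azm.
have [asm|sma] := orP (tree_below_total azm (sz m)).
  by apply: ay; exact: le_trans asm (sy m).
by apply: (nsz n); exact: le_trans (sm _ _ nm) (le_trans sma azn).
Qed.

(** The hypothesis on predecessors expresses that the height is at most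
    omega_1 + 1. *)
Lemma dense_countable_traces (K U : set (coarse_wedge T)) (x : T) :
  (forall s t, s < t -> countable [set r | r < s]) -> closed K -> K x ->
  open U -> U x -> exists y, [/\ K y, U y & countable (traces K y)].
Proof.
move=> cT clK Kx oU Ux.
have [?|ncx] := pselect (countable (traces K x)); first by exists x.
have unc : ~ countable [set r | r < x] by move=> /(countable_traces K).
have limx : limit_node x by apply: uncountable_limit_node unc => s /cT.
have [s0 s0x s0U] := limit_node_nbhs limx oU Ux.
have /choice[f /choice[g fgP]] (u : {s | s < x}) :
  exists (v : {s | s < x}) (z : T),
    [/\ sval u < sval v, K z, sval u <= z & ~ sval v <= z].
  case: u => s sx; have [s' [z [ss' s'x Kz sz s'z]]] :=
    traces_drop limx ncx (cT _ _ sx) sx.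
  by exists (exist _ s' s'x), z.
pose u n := iter n f (exist _ s0 s0x); pose s n := sval (u n).
have uP n := fgP (u n).
have sx n : s n < x := svalP (u n).
have sS n : s n < s n.+1 by case: (uP n).
have sm : {homo s : m n / (m <= n)%N >-> m <= n}.
  by apply: homo_leq => [//|? ? ?|n]; [exact: le_trans|exact/ltW].
have [|y supy] := @Tcc (range s).
  move=> _ _ [m _ <-] [n _ <-].
  by case/orP: (leq_total m n) => /sm ?; [left|right].
have [uby luby] := supy.
have yx : y <= x by apply: luby => _ [n _ <-]; exact: ltW (sx n).
(* If y were x, the predecessors of x would be covered by the countably many
   countable sets of predecessors of the s n. *)
have {yx} yx : y < x.
  move: yx; rewrite le_eqVlt => /predU1P[yx|//]; exfalso; apply: unc.
  have : countable (\bigcup_n [set r | r < s n]).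
    by apply: bigcup_countable => // n _; exact: cT (sx n).
  apply: sub_countable; apply: subset_card_le => r rx.
  apply: contrapT => nr; suff : y <= r by rewrite yx (lt_geF rx).
  apply: luby => _ [n _ <-]; have [//|sr] := boolP (s n <= r).
  exfalso; apply: nr.
  by exists n => //; rewrite /= (tree_below_ltNge (ltW rx) (ltW (sx n))).
exists y; split.
- have sz n : s n <= g (u n) by case: (uP n).
  have nsz n : ~ s n.+1 <= g (u n) by case: (uP n).
  apply: (closed_cvg K clK _ _ (drops_cvg sS supy sz nsz)).
  by exists 0%N => // n _; case: (uP n).
- apply: s0U (ltW yx); by apply: uby; exists 0%N.
- exact/countable_traces/(cT _ _ yx).
Qed.

End Wedge.

(** * Compact subspaces and maps to Hausdorff spaces *)

Lemma hausdorff_injective (X Y : topologicalType) (f : X -> Y) :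
  injective f -> continuous f -> hausdorff_space Y -> hausdorff_space X.
Proof.
move=> finj fc hY p q pq; apply/finj/hY => A B /fc fA /fc fB.
by have [x [Ax Bx]] := pq _ _ fA fB; exists (f x).
Qed.

Lemma compact_set_type (X : topologicalType) (K : set X) :
  compact K -> compact [set: set_type K].
Proof.
move=> cK F PF _; have FK : F (set_val @^-1` K).
  by apply: filterS filterT => x _; exact: set_valP.
have [p [Kp clp]] := cK (set_val @ F) _ FK.
exists (exist _ p (mem_set Kp)); split=> // A B FA [_ [[W oW <-] Wp] WB].
have FA' : F (set_val @^-1` (set_val @` A)).
  by apply: filterS FA => x Ax; exists x.
have pW : nbhs p W by apply: open_nbhs_nbhs; split.
have [_ [[x Ax <-] Wx]] := clp _ _ FA' pW.
by exists x; split=> //; exact: WB.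
Qed.

Lemma compact_embedding (X Y : topologicalType) (f : X -> Y) :
  compact [set: X] -> hausdorff_space Y -> injective f -> continuous f ->
  embedding f.
Proof.
move=> cX hY finj fc; split=> // U oU; exists (~` (f @` (~` U))).
  apply/closed_openC/(compact_closed hY)/continuous_compact.
    exact: continuous_subspaceT.
  by apply: (subclosed_compact _ cX) => //; exact: open_closedC.
rewrite eqEsubset; split=> y.
  move=> [x Ux <-]; split; last by exists x.
  by move=> [x' nUx' /finj xx']; apply: nUx'; rewrite xx'.
move=> [nUy [x _ xy]]; exists x => //.
by apply: contrapT => nUx; apply: nUy; exists x.
Qed.

Lemma continuous_mem_clopen (X Y : topologicalType) (P : set X)
    (f : bool -> Y) :
  open P -> open (~` P) -> continuous (fun x => f (x \in P)).
Proof.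
move=> oP oP' x U /nbhs_singleton; have [xP|xP] := boolP (x \in P) => Uf.
  have : nbhs x P by apply: open_nbhs_nbhs; split=> //; exact: set_mem.
  by apply: filterS => z /mem_set Pz /=; rewrite Pz.
have : nbhs x (~` P).
  by apply: open_nbhs_nbhs; split=> //; apply: set_mem; rewrite in_setC.
by apply: filterS => z /mem_set; rewrite in_setC => /negbTE Pz /=; rewrite Pz.
Qed.

(** * The embedding by traces *)

Section TraceEmbedding.
Context (R : realType) {d : Order.disp_t} (T : treeType d).
Variable K : set (coarse_wedge T).
Local Open Scope order_scope.
Local Open Scope ring_scope.
Local Open Scope classical_set_scope.

Lemma bool_in_unit (b : bool) : (b%:R : R) \in `[0%R : R, 1%R]%classic.
Proof. by rewrite mem_set //= in_itv /=; case: b; rewrite lexx ler01. Qed.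

Definition unit_bool (b : bool) : set_type `[0%R : R, 1%R]%classic :=
  exist _ b%:R (bool_in_unit b).

Lemma unit_bool_inj : injective unit_bool.
Proof.
move=> b c /(congr1 (@sval _ _)) /eqP.
by case: b; case: c => //=; rewrite ?oner_eq0 // eq_sym oner_eq0.
Qed.

Definition trace_map (x : set_type K) : cube R (set T) :=
  fun A => unit_bool (A \in traces K (set_val x : T)).

(** The trace of s on K determines whether x is above s, although it does not
    determine s. *)
Lemma tracesP (x s : T) : K x -> cf_finite s ->
  traces K x (K `&` wedge s) <-> (s <= x)%O.
Proof.
move=> Kx scf; split=> [[r [_ rx] E]|sx]; last by exists s.
by have [] : (K `&` wedge s) x by rewrite E.
Qed.

(** A coordinate is constant unless it is indexed by a trace, and then it is the
    indicator of a clopen wedge. *)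
Lemma trace_map_continuous : continuous trace_map.
Proof.
move=> x; apply/cvg_sup; first exact/fmap_filter/nbhs_filter.
move=> A; apply: continuous_comp_initial => {x}.
have [[s scf AE]|nA] := pselect (exists2 s, cf_finite s & A = K `&` wedge s).
  have E : (fun y => unit_bool (A \in traces K (set_val y : T))) =
    (fun y => unit_bool (y \in (set_val @^-1` (wedge s) : set (set_type K)))).
    apply/funext => y; congr unit_bool; apply/idP/idP; rewrite !in_setE AE.
      by move/(tracesP (set_valP y) scf).
    by move=> sy; apply/(tracesP (set_valP y) scf).
  rewrite /comp /trace_map E; apply: continuous_mem_clopen.
    by exists (wedge s) => //; exact: open_wedge.
  by exists (~` wedge s) => //; exact: open_wedgeC.
have E : (fun y => unit_bool (A \in traces K (set_val y : T))) =
         (fun y => unit_bool (y \in (set0 : set (set_type K)))).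
  apply/funext => y; congr unit_bool; rewrite in_set0; apply/negbTE/negP.
  by rewrite in_setE => -[s [scf _] AE]; apply: nA; exists s.
rewrite /comp /trace_map E; apply: continuous_mem_clopen; first exact: open0.
by rewrite setC0; exact: openT.
Qed.

(** The least node s below x that is not below y is not a limit, since a limit
    node is the supremum of its predecessors. *)
Lemma exists_separating_node (x y : T) : chain_complete T -> ~ (x <= y)%O ->
  exists s, [/\ cf_finite s, (s <= x)%O & ~ (s <= y)%O].
Proof.
move=> Tcc nxy.
have [||s [sx nsy] smin] :=
  @tree_min _ T [set s | (s <= x)%O /\ ~ (s <= y)%O] x.
- by exists x.
- by move=> s [].
exists s; split=> //; apply/cf_finiteP => -[_ dense_s].
have sy r : (r < s)%O -> (r <= y)%O.
  move=> rs; apply: contrapT => nry.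
  by have /le_gtF := smin r (conj (le_trans (ltW rs) sx) nry); rewrite rs.
have [|t [ubt lubt]] := Tcc [set r | (r < s)%O].
  move=> r r' /= rs r's; exact/orP/(tree_below_total (ltW rs) (ltW r's)).
have ts : (t <= s)%O by apply: lubt => r /ltW.
apply: nsy; move: ts; rewrite le_eqVlt => /predU1P[<-|ts]; first exact: lubt.
have [r tr rs] := dense_s _ ts.
by have := ubt _ rs; rewrite (lt_geF tr).
Qed.

Lemma trace_map_injective : chain_complete T -> injective trace_map.
Proof.
move=> Tcc x y xy; apply: val_inj; apply: le_anti; apply/andP.
have half (u v : set_type K) :
    trace_map u = trace_map v -> (set_val u <= set_val v)%O.
  move=> uv; apply: contrapT => /(exists_separating_node Tcc)[s [scf su nsv]].
  apply: nsv; apply/(tracesP (set_valP v) scf); apply: set_mem.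
  have /unit_bool_inj <- := congr1 (fun f => f (K `&` wedge s)) uv.
  by apply: mem_set; apply/(tracesP (set_valP u) scf).
by split; apply: half.
Qed.

Lemma Sigma_trace_map x :
  countable (traces K (set_val x : T)) -> Sigma (trace_map x).
Proof.
apply: sub_countable; apply: subset_card_le => A /= nz; apply: contrapT => nA.
by apply: nz; rewrite /trace_map /unit_bool set_valE /= memNset.
Qed.

End TraceEmbedding.

Theorem proposition2p3 (R : realType) (d : Order.disp_t) (T : treeType d)
  (h : onum) (K : set (coarse_wedge T))
  (T_rooted : rooted T) (T_chain_complete : chain_complete T)
  (T_height : is_height T h) (h_le : oleq h (onumS onum_omega1))
  (K_closed : closed K) :
  valdivia R (set_type K).
Proof.
have hcube : hausdorff_space (cube R (set T)).
  apply: hausdorff_product => A; apply: (@hausdorff_injective _ R set_val).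
  - exact: val_inj.
  - exact: initial_continuous.
  - exact: Rhausdorff.
have ci := @trace_map_continuous R d T K.
have ii := @trace_map_injective R d T K T_chain_complete.
have cK : compact [set: set_type K].
  apply/compact_set_type/(subclosed_compact K_closed).
    exact: compact_coarse_wedge T_chain_complete.
  exact: subsetT.
split=> //; first exact: hausdorff_injective ii ci hcube.
exists (set T), (trace_map R (K := K)); split; first exact: compact_embedding.
move=> O [x Ox] [U oU UO]; rewrite -UO in Ox *.
have [|y [Ky Uy cy]] :=
  dense_countable_traces T_chain_complete _ K_closed (set_valP x) oU Ox.
  by move=> s t; exact: tree_below_countable T_height h_le.
exists (exist _ y (mem_set Ky)); split=> //.
exact: Sigma_trace_map.
Qed.
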